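(* Let $1\le r<\infty$ and let $\mathcal A$ be a (real- or complex-valued) function on $\mathbb J_0=[1,2]\times[2^{-3},2^{-2}]$. Then $$\sup_{(t,s)\in\mathbb J_0}|\mathcal A(t,s)|\le[\mathcal A]_{r,2}.$$
   Context: One-parameter variation: for a function $a$ on an interval $I$, $[a]_{r,1}=\sup_{L\in\mathbb N}\sup_{t_1<\cdots<t_L,\ t_j\in I}\big(\sum_{j=1}^{L-1}|a(t_{j+1})-a(t_j)|^r\big)^{1/r}$. Rectangular variation: for a rectangle $Q=[t_1,t_2]\times[s_1,s_2]\subset\mathbb J_0$, $\mathcal A(Q)=\mathcal A(t_2,s_2)-\mathcal A(t_1,s_2)+\mathcal A(t_1,s_1)-\mathcal A(t_2,s_1)$, and $\{\mathcal A\}_{r,2}=\sup\big(\sum_{j,k}|\mathcal A(I_j\times J_k)|^r\big)^{1/r}$, the supremum being over all finite partitions of $[1,2]$ into intervals $\{I_j\}$ and of $[2^{-3},2^{-2}]$ into intervals $\{J_k\}$ (closed intervals with disjoint interiors). Two-parameter variation norm: $[\mathcal A]_{r,2}=\{\mathcal A\}_{r,2}+[\mathcal A(1,\cdot)]_{r,1}+[\mathcal A(\cdot,2^{-3})]_{r,1}+|\mathcal A(1,2^{-3})|$ (possibly $+\infty$), where $\mathcal A(1,\cdot)$ is a function on $[2^{-3},2^{-2}]$ and $\mathcal A(\cdot,2^{-3})$ a function on $[1,2]$. *)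

(* Defs.v *)
From mathcomp Require Import all_boot all_order all_algebra.
From mathcomp Require Import complex.
From mathcomp Require Import all_classical all_reals all_analysis.

Set Implicit Arguments.
Unset Strict Implicit.
Unset Printing Implicit Defensive.

Import Order.TTheory GRing.Theory Num.Theory.

Local Open Scope classical_set_scope.
Local Open Scope ring_scope.

(* Values are taken in an arbitrary V : normedZmodType R, so that the same
   definitions serve V = R and V = Rcomplex R, the library's alias of R[i] whose
   norm is the modulus, as an element of R.  A function on a subset of R (or of
   R * R) is a total function, of which only the values there are used. *)

(* The points t_1 < ... < t_L are t 0, ..., t L.-1. *)
Definition variation1 (R : realType) (V : normedZmodType R)
    (r : R) (I : interval R) (a : R -> V) : \bar R :=
  ereal_sup [set v : \bar R | exists (L : nat) (t : nat -> R),
    [/\ (1 <= L)%N,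
        forall j, (j < L)%N -> t j \in I,
        forall j, (j.+1 < L)%N -> t j < t j.+1 &
        v = ((\sum_(j < L.-1) `|a (t j.+1) - a (t j)| `^ r) `^ r^-1)%:E]].

(* A(Q) for Q = [t1, t2] x [s1, s2]. *)
Definition rect_incr (R : realType) (V : normedZmodType R)
    (A : R -> R -> V) (t1 t2 s1 s2 : R) : V :=
  A t2 s2 - A t1 s2 + A t1 s1 - A t2 s1.

(* A partition of [a, b] is its sequence p of right endpoints (itv_partition);
   its intervals are [(a :: p)_j, p_j] for j < size p. *)
Definition rect_variation (R : realType) (V : normedZmodType R)
    (r : R) (A : R -> R -> V) : \bar R :=
  ereal_sup [set v : \bar R | exists (p q : seq R),
    [/\ itv_partition (1 : R) 2 p,
        itv_partition (2 ^- 3 : R) (2 ^- 2) q &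
        v = ((\sum_(j < size p) \sum_(k < size q)
               `|rect_incr A ((1 :: p)`_j) (p`_j)
                   ((2 ^- 3 :: q)`_k) (q`_k)| `^ r) `^ r^-1)%:E]].

Definition variation2 (R : realType) (V : normedZmodType R)
    (r : R) (A : R -> R -> V) : \bar R :=
  (rect_variation r A
  + variation1 r `[2 ^- 3, 2 ^- 2]%R (fun s => A 1%R s)
  + variation1 r `[1, 2]%R (fun t => A t (2 ^- 3)%R)
  + `|A 1 (2 ^- 3)|%R%:E)%E.

Definition J0 (R : realType) : set (R * R) :=
  `[1, 2] `*` `[2 ^- 3, 2 ^- 2].

Definition sup_J0 (R : realType) (V : normedZmodType R)
    (A : R -> R -> V) : \bar R :=
  ereal_sup [set `|A p.1 p.2|%:E | p in @J0 R].

(* Main.v *)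
(* Telescoping: with s0 = 2^-3,
   A(t,s) = A([1,t] x [s0,s]) + (A(1,s) - A(1,s0)) + (A(t,s0) - A(1,s0)) + A(1,s0),
   and each term is dominated by the corresponding term of [A]_{r,2}: the
   rectangle [1,t] x [s0,s] is a cell of a product partition, unless it is
   degenerate, in which case its increment vanishes. *)

Require Import Defs.
From mathcomp Require Import all_boot all_order all_algebra.
From mathcomp Require Import complex.
From mathcomp Require Import all_classical all_reals all_analysis.

Set Implicit Arguments.
Unset Strict Implicit.
Unset Printing Implicit Defensive.

Import Order.TTheory GRing.Theory Num.Theory.
Local Open Scope ring_scope.

(** Extracts one term from an r-variation: once the r-th power of a single increment is at most the
    whole sum [y], the increment is at most the root of [y]. It rests on writing [x] as the r-th
    root of its r-th power and on monotonicity of the root on nonnegative reals. *)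
Lemma powR_le_root (R : realType) (r x y : R) :
  0 < r -> 0 <= x -> x `^ r <= y -> x <= y `^ r^-1.
Proof.
move=> r0 x0 xy; rewrite -[leLHS](@powRr1 R)// -(mulfV (lt0r_neq0 r0)) powRrM.
apply: ge0_ler_powR => //; rewrite ?nnegrE ?powR_ge0 ?invr_ge0 ?(ltW r0)//.
exact: le_trans (powR_ge0 _ _) xy.
Qed.

Lemma norm_increment_le_variation1 (R : realType) (V : normedZmodType R)
    (r : R) (I : interval R) (a : R -> V) (x y : R) :
  0 < r -> x \in I -> y \in I -> x <= y ->
  (`|a y - a x|%:E <= variation1 r I a)%E.
Proof.
move=> r0 xI yI; rewrite le_eqVlt => /predU1P[<-|xy].
  (* Equal endpoints cannot form a strictly increasing pair, so the one-point sequence is used: its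
     sum is empty. *)
  apply: le_ereal_sup_tmp; exists ((\sum_(j < 0) 0) `^ r^-1)%:E; last first.
    by rewrite subrr normr0 lee_fin powR_ge0.
  exists 1%N, (fun=> x); split => //.
  by congr (_ `^ _)%:E; rewrite !big_ord0.
apply: le_ereal_sup_tmp; exists ((`|a y - a x| `^ r) `^ r^-1)%:E; last first.
  by rewrite lee_fin powR_le_root.
(* The two-point sequence [x], [y] has the single increment [a y - a x]. *)
exists 2%N, (fun j => if j is 0%N then x else y); split => //.
- by case.
- by case.
- by rewrite big_ord1.
Qed.

(** Makes [[a, x]] the first cell of a partition; the case [x = b] is separate because the endpoints
    must increase strictly. *)
Lemma itv_partition_head (R : realType) (a b x : R) :
  a < x -> x <= b -> exists p, itv_partition a b (x :: p).
Proof.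
move=> ax; rewrite le_eqVlt => /predU1P[<-|xb].
  by exists [::]; exact: itv_partition1.
by exists [:: b]; split; rewrite /= ?ax ?xb.
Qed.

(** Serves the degenerate rectangles. A supremum is nonnegative only if some nonnegative value is
    attained; the partition with a single cell supplies one. *)
Lemma rect_variation_ge0 (R : realType) (V : normedZmodType R)
    (r : R) (A : R -> R -> V) : (0 <= rect_variation r A)%E.
Proof.
have lt12 : (1 : R) < 2 by rewrite ltr1n.
have lt84 : (2 ^- 3 : R) < 2 ^- 2.
  by rewrite ltf_pV2 ?posrE ?exprn_gt0// ltr_eXn2l.
apply: le_ereal_sup_tmp; eexists.
  by exists [:: 2], [:: 2 ^- 2]; split=> //; exact: itv_partition1.
by rewrite lee_fin powR_ge0.
Qed.

Lemma norm_rect_incr_le_rect_variation (R : realType) (V : normedZmodType R)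
    (r : R) (A : R -> R -> V) (t s : R) :
  0 < r -> 1 <= t <= 2 -> 2 ^- 3 <= s <= 2 ^- 2 ->
  (`|rect_incr A 1 t (2 ^- 3) s|%:E <= rect_variation r A)%E.
Proof.
move=> r0 /andP[+ t2] /andP[+ s2].
rewrite le_eqVlt => /predU1P[<- _|t1].
  by rewrite /rect_incr subrr add0r subrr normr0 rect_variation_ge0.
rewrite le_eqVlt => /predU1P[<-|s1].
  by rewrite /rect_incr subrK subrr normr0 rect_variation_ge0.
have [p pP] := itv_partition_head t1 t2.
have [q qP] := itv_partition_head s1 s2.
apply: le_ereal_sup_tmp; eexists; first by exists (t :: p), (s :: q); split.
(* The rectangle is the cell of indices (0, 0); peeling off the first row, then its first entry,
   leaves a sum of nonnegative terms. *)
rewrite lee_fin powR_le_root//= big_ord_recl big_ord_recl/= -addrA lerDl.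
by rewrite addr_ge0// !sumr_ge0// => *; rewrite ?sumr_ge0// => *; rewrite powR_ge0.
Qed.

Lemma sup_J0_le_variation2 (R : realType) (V : normedZmodType R)
    (r : R) (A : R -> R -> V) : 0 < r -> (sup_J0 A <= variation2 r A)%E.
Proof.
move=> r0; apply: ge_ereal_sup => _ [[t s] [/= tI sI] <-].
move: (tI) (sI); rewrite !in_itv/= => t12 s12.
have [[t1 t2] [s1 s2]] := (andP t12, andP s12).
have -> : A t s = rect_incr A 1 t (2 ^- 3) s + (A 1 s - A 1 (2 ^- 3))
    + (A t (2 ^- 3) - A 1 (2 ^- 3)) + A 1 (2 ^- 3).
  rewrite -[RHS]addrA subrK addrAC /rect_incr subrK -[RHS]addrA.
  by rewrite [A 1 (2 ^- 3) + _]addrC subrK subrK.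
apply: (@le_trans _ _ (`|rect_incr A 1 t (2 ^- 3) s|%:E
    + `|A 1 s - A 1 (2 ^- 3)|%:E + `|A t (2 ^- 3) - A 1 (2 ^- 3)|%:E
    + `|A 1 (2 ^- 3)|%:E)%E).
  rewrite -!EFinD lee_fin (le_trans (ler_normD _ _))// lerD2r.
  by rewrite (le_trans (ler_normD _ _))// lerD2r ler_normD.
(* Comparison term by term; the corner terms coincide. Each one-parameter increment starts at the
   left endpoint of its interval. *)
rewrite /variation2 leeD// leeD//; last first.
  apply: (@norm_increment_le_variation1 _ _ _ _ (A^~ (2 ^- 3))) => //.
  by rewrite in_itv/= lexx (le_trans t1 t2).
rewrite leeD ?norm_rect_incr_le_rect_variation//.
apply: norm_increment_le_variation1 => //.
by rewrite in_itv/= lexx (le_trans s1 s2).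
Qed.

Theorem proposition2p4 (R : realType) (r : R) (hr : (1 <= r)%R) :
  (forall A : R -> R -> R, (sup_J0 A <= variation2 r A)%E) /\
  (forall A : R -> R -> Rcomplex R, (sup_J0 A <= variation2 r A)%E).
Proof. by split => A; apply/sup_J0_le_variation2/(lt_le_trans ltr01 hr). Qed.
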